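(* Let $n=6$ and let $\Omega\ge 1$ be a real number. Then $$q(u;\mathbf{r})\le\Omega$$ for all $u>0$ and all $\mathbf{r}\in\mathcal{B}=[\Omega^{-1},\Omega]^{6}$.
   Context: For an integer $n\ge 1$, a real $u>0$ and a vector $\mathbf{r}=(r_1,\dots,r_n)$ of positive reals, define $$a_i(u;\mathbf{r})=\binom{n}{i}\Bigl(\prod_{j=1}^{i}r_j\Bigr)u^{i}\quad(0\le i\le n),\qquad p_i=\frac{a_i(u;\mathbf{r})}{\sum_{j=0}^{n}a_j(u;\mathbf{r})},\qquad \bar\mu=\sum_{j=0}^{n}j\,p_j,$$ where the empty product equals $1$, and $$q(u;\mathbf{r})=\frac{(1+u)^2}{n\,u}\sum_{i=0}^{n}(i-\bar\mu)^2p_i.$$ *)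

(* Defs.v *)
From mathcomp Require Import all_boot all_order all_algebra.
From mathcomp Require Import reals.

Set Implicit Arguments.
Unset Strict Implicit.
Unset Printing Implicit Defensive.

Import Order.TTheory GRing.Theory Num.Theory.

Local Open Scope ring_scope.

Section BindingPolynomial.
Context {R : realType} {n : nat}.
Implicit Types (u : R) (r : 'rV[R]_n) (i : nat).

(* The entry r_j of the 1-based mathematical notation is [r 0 k] with
   [k = j - 1 : 'I_n], so that j ranges over 1..i exactly when k < i. *)
Definition a u r i : R :=
  'C(n, i)%:R * (\prod_(k < n | (k < i)%N) r 0 k) * u ^+ i.

Definition p u r i : R := a u r i / \sum_(j < n.+1) a u r j.

Definition mean u r : R := \sum_(j < n.+1) j%:R * p u r j.

Definition q u r : R :=
  (1 + u) ^+ 2 / (n%:R * u) * \sum_(i < n.+1) (i%:R - mean u r) ^+ 2 * p u r i.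

End BindingPolynomial.

(* Main.v *)
(* Let mu be the mean of p and v_k(i) = C(6,i) u^i Omega^|i-k|.  The mean of v_0
   is at least mu and that of v_6 at most mu, so for some k a nonnegative
   combination b = s v_k + t v_{k+1} has mean exactly mu.  As all the r_j lie in
   [1/Omega, Omega], the ratio b/a is nonincreasing up to k and nondecreasing from
   k+1 on; since b and a have the same mean, b has the larger variance.
   It remains to see Var(b) <= T := 6 u Omega / (1+u)^2, i.e. that the quadratic
   form T m0^2 - (m0 m2 - m1^2) in the moments m0, m1, m2 is nonnegative at
   s v_k + t v_{k+1}.  All its coefficients in s, t turn out to be nonnegative:
   after rescaling u by Omega or 1/Omega, these are inequalities between integer
   polynomials in two variables, which are decided by computation. *)
Require Import Defs.
From Stdlib Require Import ZArith.
From mathcomp Require Import all_boot all_order all_algebra.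
From mathcomp Require Import reals.
From mathcomp Require Import ssrZ zify ring.

Set Implicit Arguments.
Unset Strict Implicit.
Unset Printing Implicit Defensive.

Import Order.TTheory GRing.Theory Num.Theory.

Local Open Scope ring_scope.

(** * Coefficient lists and a nonnegativity test on the half-line *)

Section ListPolynomials.
Context {C : Type} (zero : C) (add mul : C -> C -> C).

Fixpoint padd (p q : seq C) : seq C :=
  match p, q with
  | [::], _ => q
  | _, [::] => p
  | c :: p', d :: q' => add c d :: padd p' q'
  end.

Fixpoint pmul (p q : seq C) : seq C :=
  if p is c :: p' then padd (map (mul c) q) (zero :: pmul p' q) else [::].

(* p(X + 1) *)
Fixpoint pshift (p : seq C) : seq C :=
  if p is c :: p' then
    let s := pshift p' in padd [:: c] (padd s (zero :: s))
  else [::].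

(* Nonnegativity on [0, +oo[ by bisection at 1: substitute x = 1 + y on [1, +oo[
   and x = 1 / (1 + y) on ]0, 1].  We write [if] rather than [&&], both sides of
   which [vm_compute] would evaluate. *)
Fixpoint ppos (posc : C -> bool) (n : nat) (p : seq C) : bool :=
  if all posc p then true else
  if n isn't n'.+1 then false else
  if ~~ posc (head zero p) then false else
  if ppos posc n' (pshift p) then ppos posc n' (pshift (rev p)) else false.

Context {R : realFieldType} (ev : C -> R).
Hypothesis ev0 : ev zero = 0.
Hypothesis evD : {morph ev : c d / add c d >-> c + d}.
Hypothesis evM : {morph ev : c d / mul c d >-> c * d}.

Fixpoint peval (x : R) (p : seq C) : R :=
  if p is c :: p' then ev c + x * peval x p' else 0.

Lemma peval_add x : {morph peval x : p q / padd p q >-> p + q}.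
Proof.
elim=> [|c p IH] [|d q] /=; rewrite ?add0r ?addr0 //.
by rewrite IH evD; ring.
Qed.

Lemma peval_mul x : {morph peval x : p q / pmul p q >-> p * q}.
Proof.
move=> p q; elim: p => [|c p IH] /=; first by rewrite mul0r.
rewrite peval_add /= IH ev0 add0r mulrDl mulrA; congr (_ + _).
elim: q {IH} => [|d q IH] /=; first by rewrite mulr0.
by rewrite IH evM; ring.
Qed.

Lemma peval_shift x p : peval x (pshift p) = peval (1 + x) p.
Proof.
elim: p => //= c p IH.
by rewrite (peval_add x [:: c]) peval_add /= IH ev0; ring.
Qed.

(** The exponent [size p] is one more than the formal degree, hence the extra factor [x] on the
    right. *)
Lemma peval_rev x y p : x * y = 1 ->
  x ^+ size p * peval y (rev p) = x * peval x p.
Proof.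
move=> xy1; have peval_rcons q c :
    peval y (rcons q c) = peval y q + y ^+ size q * ev c.
  by elim: q => [|d q IH] /=; rewrite ?IH ?exprS; ring.
elim: p => [|c p IH] /=; first by rewrite !mulr0.
rewrite rev_cons peval_rcons size_rev exprS mulrDr -mulrA IH.
have xyn : x ^+ size p * y ^+ size p = 1 by rewrite -exprMn xy1 expr1n.
transitivity (x * (x * peval x p) + x * (x ^+ size p * y ^+ size p) * ev c).
  by ring.
by rewrite xyn; ring.
Qed.

Lemma ppos_ge0 (posc : C -> bool) n p x : (forall c, posc c -> 0 <= ev c) ->
  ppos posc n p -> 0 <= x -> 0 <= peval x p.
Proof.
move=> poscP; have all_ge0 q y : all posc q -> 0 <= y -> 0 <= peval y q.
  move=> + y0; elim: q => //= c q IH /andP[/poscP c0 /IH q0].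
  by rewrite addr_ge0 // mulr_ge0.
elim: n p x => [|n IH] p x /=; first by case: ifP => // /all_ge0 + _; apply.
case: ifP => [/all_ge0 + _|_]; first exact.
case: ifPn => // /negPn/poscP hd0; case: ifP => // pos1 pos2 x0.
have [x1|x1] := lerP 1 x.
  by rewrite -[x](subrKC 1) -peval_shift IH // subr_ge0.
(* Inversion misses [x = 0], where the value is the constant coefficient. *)
move: x0; rewrite le_eqVlt => /orP[/eqP<-|x0].
  by case: (p) hd0 => //= c q; rewrite mul0r addr0.
have xV : x * x^-1 = 1 by rewrite divff ?gt_eqF.
rewrite -(pmulr_rge0 _ x0) -(peval_rev p xV) mulr_ge0 ?exprn_ge0 ?(ltW x0) //.
rewrite -[x^-1](subrKC 1) -peval_shift IH // subr_ge0.
by rewrite invf_ge1 // ltW.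
Qed.

End ListPolynomials.

(* Integer polynomials in x, resp. in Om with coefficients polynomials in x;
   [mono2 c i j] is c x^i Om^j. *)
Definition add1 := padd Z.add.
Definition mul1 := pmul Z0 Z.add Z.mul.
Definition add2 := padd add1.
Definition mul2 := pmul [::] add1 mul1.
Definition mono2 (c : Z) (i j : nat) : seq (seq Z) :=
  ncons j [::] [:: ncons i Z0 [:: c]].

Definition moment2 (e : nat -> nat) (d : nat) : seq (seq Z) :=
  foldr (fun i => add2 (mono2 (Z.of_nat (i ^ d * 'C(6, i))) i (e i))) [::]
    (iota 0 7).

(* 12 x Om^2 A0 B0 - (Om^s + x Om^t)^2 (A0 B2 + A2 B0 - 2 A1 B1), where A and B
   are the moments of the weights C(6,i) x^i Om^(e i) and C(6,i) x^i Om^(e' i). *)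
Definition slack2 (e e' : nat -> nat) (s t : nat) : seq (seq Z) :=
  let m d := moment2 e d in let m' d := moment2 e' d in
  let l := add2 (mono2 (Zpos 1) 0 s) (mono2 (Zpos 1) 1 t) in
  add2 (mul2 (mono2 (Zpos 12) 1 2) (mul2 (m 0%N) (m' 0%N)))
    (mul2 (mono2 (Zneg 1) 0 0) (mul2 (mul2 l l)
      (add2 (add2 (mul2 (m 0%N) (m' 2%N)) (mul2 (m 2%N) (m' 0%N)))
        (mul2 (mono2 (Zneg 2) 0 0) (mul2 (m 1%N) (m' 1%N)))))).

(* Substituting Om = 1 + w, the depths of bisection are 5 in w and 3 in x. *)
Definition slack2_check (e e' : nat -> nat) (s t : nat) : bool :=
  ppos [::] add1 (ppos Z0 Z.add (Z.leb Z0) 3) 5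
    (pshift [::] add1 (slack2 e e' s t)).

(** * Evaluation of the two-variable integer polynomials *)

Section Evaluation.
Context {R : realFieldType}.
Implicit Types (Om x : R) (P Q : seq (seq Z)).

Definition evalZ (z : Z) : R := (int_of_Z z)%:~R.
Definition eval2 Om x P : R := peval (peval evalZ x) Om P.

Lemma evalZD : {morph evalZ : y z / Z.add y z >-> y + z}.
Proof.
move=> y z; rewrite /evalZ -intrD; congr _%:~R; lia.
Qed.

Lemma evalZM : {morph evalZ : y z / Z.mul y z >-> y * z}.
Proof.
move=> y z; rewrite /evalZ -intrM; congr _%:~R; lia.
Qed.

Lemma evalZ_ge0 z : Z.leb Z0 z -> 0 <= evalZ z.
Proof. by move=> z0; rewrite ler0z; lia. Qed.

Lemma eval2D Om x : {morph eval2 Om x : P Q / add2 P Q >-> P + Q}.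
Proof. exact/peval_add/peval_add/evalZD. Qed.

Lemma eval2M Om x : {morph eval2 Om x : P Q / mul2 P Q >-> P * Q}.
Proof.
apply: peval_mul => //; first exact/peval_add/evalZD.
by apply: peval_mul => //; [exact: evalZD | exact: evalZM].
Qed.

Lemma eval2_mono Om x c i j :
  eval2 Om x (mono2 c i j) = evalZ c * x ^+ i * Om ^+ j.
Proof.
rewrite /eval2 /mono2; elim: j => [|j IH]; last first.
  by rewrite /= IH add0r exprS; ring.
rewrite /= mulr0 addr0 expr0 mulr1; elim: i => [|i IH] /=.
  by rewrite mulr0 addr0 expr0 mulr1.
by rewrite IH /evalZ /= add0r exprS; ring.
Qed.

Definition moment (a : nat -> R) (d : nat) : R :=
  \sum_(i < 7) i%:R ^+ d * a i.

Lemma eval2_moment Om x e d : eval2 Om x (moment2 e d) =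
  moment (fun i => 'C(6, i)%:R * x ^+ i * Om ^+ e i) d.
Proof.
rewrite /moment -(big_mkord xpredT
  (fun i => i%:R ^+ d * ('C(6, i)%:R * x ^+ i * Om ^+ e i))) /index_iota subn0.
rewrite /moment2; elim: iota => [|i s IH]; first by rewrite big_nil.
rewrite [foldr _ _ _]/= eval2D IH big_cons eval2_mono; congr (_ + _).
have -> : evalZ (Z.of_nat (i ^ d * 'C(6, i))) = i%:R ^+ d * 'C(6, i)%:R.
  rewrite -natrX -natrM /evalZ -[RHS]/(Posz _)%:~R; congr _%:~R; lia.
by rewrite !mulrA.
Qed.

(** The test is nested: the coefficients in [w = Om - 1] are polynomials in [x], and their
    nonnegativity for [x >= 0] is itself settled by bisection. *)
Lemma slack2_ge0 Om x e e' s t (a b : nat -> R) :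
  1 <= Om -> 0 <= x -> slack2_check e e' s t ->
  (forall i, a i = 'C(6, i)%:R * x ^+ i * Om ^+ e i) ->
  (forall i, b i = 'C(6, i)%:R * x ^+ i * Om ^+ e' i) ->
  (Om ^+ s + x * Om ^+ t) ^+ 2 *
    (moment a 0 * moment b 2 + moment a 2 * moment b 0
     - 2 * (moment a 1 * moment b 1))
  <= 12 * x * Om ^+ 2 * (moment a 0 * moment b 0).
Proof.
move=> Om1 x0 chk aE bE.
have : 0 <= eval2 Om x (slack2 e e' s t).
  rewrite /eval2 -[Om](subrKC 1) -(peval_shift (zero := [::]) (add := add1)) //;
    last exact/peval_add/evalZD.
  apply: ppos_ge0 chk _ => //; first exact/peval_add/evalZD.
    move=> c c0; apply: ppos_ge0 c0 x0 => //; first exact: evalZD.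
    exact: evalZ_ge0.
  by rewrite subr_ge0.
rewrite /slack2 !(eval2D, eval2M, eval2_mono, eval2_moment).
have momentE c c' d : (forall i, c i = c' i) -> moment c d = moment c' d.
  by move=> cE; apply: eq_bigr => i _; rewrite cE.
rewrite -!(momentE _ _ _ aE) -!(momentE _ _ _ bE).
move=> slack_ge0; rewrite -subr_ge0; apply: (le_trans slack_ge0).
rewrite le_eqVlt; apply/predU1P; left.
have [-> -> -> ->] : [/\ evalZ (Zpos 12) = 12, evalZ (Zneg 1) = -1,
    evalZ (Zpos 1) = 1 & evalZ (Zneg 2) = -2] by [].
ring.
Qed.

End Evaluation.

(** * Variance bound for the weights v_k, in polarized form *)

Section Slack.
Context {R : realFieldType}.
Implicit Types (u Om : R) (k l : nat).

(** Subtraction being truncated, the exponent is |i - k|. *)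
Definition vee u Om k i : R :=
  'C(6, i)%:R * u ^+ i * Om ^+ ((i - k) + (k - i)).

(** The last two arguments encode [1 + u], which is [(Om + x) / Om] for [x = u * Om] and
    [1 + x * Om] for [x = u / Om]. Switching between the two at 3 keeps the exponents of [Om] in the
    weights at most 6. *)
Lemma slack2_check_all :
  all (fun k =>
    [&& (k <= 3) ==>
          slack2_check (fun i => 2 * (k - i)) (fun i => 2 * (k - i)) 1 0,
        (k < 3) ==>
          slack2_check (fun i => 2 * (k - i)) (fun i => 2 * (k.+1 - i)) 1 0,
        (3 < k) ==>
          slack2_check (fun i => 2 * (i - k)) (fun i => 2 * (i - k)) 0 1 &
        (3 <= k < 6) ==>
          slack2_check (fun i => 2 * (i - k)) (fun i => 2 * (i - k.+1)) 0 1]%N)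
    (iota 0 7).
Proof. by vm_compute. Qed.

(* With x = u Om if l <= 3 and x = u / Om otherwise, |i - k| becomes the exponent
   2 (k - i), resp. 2 (i - k), with truncated subtraction. *)
Lemma vee_slack_ge0 u Om k l : 0 < u -> 1 <= Om ->
  (k <= 6)%N -> (l <= 6)%N -> l = k \/ l = k.+1 ->
  (1 + u) ^+ 2 *
    (moment (vee u Om k) 0 * moment (vee u Om l) 2
     + moment (vee u Om k) 2 * moment (vee u Om l) 0
     - 2 * (moment (vee u Om k) 1 * moment (vee u Om l) 1))
  <= 12 * u * Om * (moment (vee u Om k) 0 * moment (vee u Om l) 0).
Proof.
move=> u0 Om1 k6 l6 kl; have Om0 : 0 < Om by apply: lt_le_trans Om1.
have Omn0 := lt0r_neq0 Om0.
have momentZ (c : R) (a b : nat -> R) d :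
    (forall i, a i = c * b i) -> moment a d = c * moment b d.
  move=> abE; rewrite /moment mulr_sumr.
  by apply: eq_bigr => i _; rewrite abE mulrCA.
have /allP/(_ k) := slack2_check_all.
rewrite mem_iota add0n ltnS k6 => /(_ isT) /and4P[c1 c2 c3 c4].
have [l3|l3] := leqP l 3.
- pose a m i : R := 'C(6, i)%:R * (u * Om) ^+ i * Om ^+ (2 * (m - i)).
  have aE m i : vee u Om m i = Om ^- m * a m i.
    rewrite /vee /a exprMn.
    have -> : Om ^+ (i - m + (m - i)) =
        Om ^- m * (Om ^+ i * Om ^+ (2 * (m - i))).
      rewrite -exprD; apply: (canRL (mulKf _)); first by rewrite expf_neq0.
      by rewrite -exprD; congr (_ ^+ _); lia.
    by ring.
  rewrite !(momentZ _ _ _ _ (aE k)) !(momentZ _ _ _ _ (aE l)).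
  have chk : slack2_check (fun i => 2 * (k - i))%N (fun i => 2 * (l - i))%N 1 0.
    by case: kl l3 l6 => -> l3 _; [move: c1 | move: c2]; rewrite l3.
  have := @slack2_ge0 R Om (u * Om) _ _ 1 0 (a k) (a l) Om1
    (ltW (mulr_gt0 u0 Om0)) chk (fun=> erefl) (fun=> erefl).
  set A0 := moment _ 0; set B0 := moment _ 0; set A1 := moment _ 1.
  set B1 := moment _ 1; set A2 := moment _ 2; set B2 := moment _ 2 => H.
  (* The first two factors undo the rescaling of the weights; [Om ^+ 2] is the denominator of
     [(1 + u) ^+ 2] in terms of [x]. *)
  have c0 : 0 <= Om ^- k * Om ^- l / Om ^+ 2.
    by rewrite divr_ge0 ?mulr_ge0 ?invr_ge0 ?exprn_ge0 // ltW.
  move: (Om ^- k) (Om ^- l) c0 H => K L {chk c1 c2 c3 c4 aE} c0 H.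
  rewrite -subr_ge0; move: H; rewrite -subr_ge0.
  set D := (X in 0 <= X -> _) => D0.
  rewrite [leRHS](_ : _ = K * L / Om ^+ 2 * D); first exact: mulr_ge0.
  rewrite /D.
  by field.
- pose a m i : R := 'C(6, i)%:R * (u / Om) ^+ i * Om ^+ (2 * (i - m)).
  have aE m i : vee u Om m i = Om ^+ m * a m i.
    rewrite /vee /a exprMn exprVn.
    have -> : Om ^+ (i - m + (m - i)) =
        Om ^+ m * (Om ^- i * Om ^+ (2 * (i - m))).
      rewrite mulrCA -exprD; apply: (canRL (mulKf _)); first by rewrite expf_neq0.
      by rewrite -exprD; congr (_ ^+ _); lia.
    by ring.
  rewrite !(momentZ _ _ _ _ (aE k)) !(momentZ _ _ _ _ (aE l)).
  have chk : slack2_check (fun i => 2 * (i - k))%N (fun i => 2 * (i - l))%N 0 1.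
    case: kl l3 l6 => -> l3 l6; first by move: c3; rewrite l3.
    by move: c4; rewrite l6 -ltnS l3.
  have := @slack2_ge0 R Om (u / Om) _ _ 0 1 (a k) (a l) Om1
    (ltW (divr_gt0 u0 Om0)) chk (fun=> erefl) (fun=> erefl).
  set A0 := moment _ 0; set B0 := moment _ 0; set A1 := moment _ 1.
  set B1 := moment _ 1; set A2 := moment _ 2; set B2 := moment _ 2 => H.
  have c0 : 0 <= Om ^+ k * Om ^+ l by rewrite mulr_ge0 ?exprn_ge0 // ltW.
  move: (Om ^+ k) (Om ^+ l) c0 H => K L {chk c1 c2 c3 c4 aE} c0 H.
  rewrite -subr_ge0; move: H; rewrite -subr_ge0.
  set D := (X in 0 <= X -> _) => D0.
  rewrite [leRHS](_ : _ = K * L * D); first exact: mulr_ge0.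
  rewrite /D.
  by field.
Qed.

End Slack.

(** * Effect of reweighting on mean and variance *)

Section Statistics.
Context {R : realFieldType}.
Implicit Types (a g : nat -> R) (mu : R) (n : nat).

(** Centering allows any constant [G] to be subtracted from [g]. With [G] the value of [g] at the
    first index not below [mu], [g - G] has the sign of [i - mu], so every term is nonnegative. *)
Lemma nondecreasing_tilt_mean n a g mu :
  (forall i, (i <= n)%N -> 0 <= a i) ->
  (forall i j, (i <= j <= n)%N -> g i <= g j) ->
  \sum_(i < n.+1) (i%:R - mu) * a i = 0 ->
  0 <= \sum_(i < n.+1) (i%:R - mu) * (a i * g i).
Proof.
move=> a0 gmono centered.
have [G GP] : exists G, forall i, (i <= n)%N -> 0 <= (i%:R - mu) * (g i - G).
  have [/existsP[j0 j0mu]|/existsPn nomu] :=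
      boolP [exists j : 'I_n.+1, mu <= j%:R].
    have exj : exists j, (j <= n)%N && (mu <= j%:R).
      by exists j0; rewrite leq_ord.
    case: (ex_minnP exj) => j /andP[jn muj] jmin; exists (g j) => i ilen.
    have [muiL|imu] := lerP mu i%:R.
      by rewrite mulr_ge0 ?subr_ge0 // gmono // jmin ?ilen.
    rewrite mulr_le0 ?subr_le0 ?(ltW imu) // gmono // jn andbT.
    by rewrite -(ler_nat R) (le_trans (ltW imu)).
  (* All indices lie below [mu], so [G] need only be an upper bound of [g]. *)
  exists (g n) => i ilen; have := nomu (Ordinal (ilen : (i < n.+1)%N)).
  rewrite -ltNge => imu.
  by rewrite mulr_le0 ?subr_le0 ?(ltW imu) // gmono // ilen leqnn.
suff : 0 <= \sum_(i < n.+1) (i%:R - mu) * (a i * g i)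
    - G * \sum_(i < n.+1) (i%:R - mu) * a i by rewrite centered mulr0 subr0.
rewrite mulr_sumr -sumrB; apply: sumr_ge0 => i _.
have -> : (i%:R - mu) * (a i * g i) - G * ((i%:R - mu) * a i)
    = a i * ((i%:R - mu) * (g i - G)) by ring.
by rewrite mulr_ge0 ?a0 ?GP ?leq_ord.
Qed.

(* Where the ratio [g] exceeds its mean [lam], the new weights exceed the rescaled
   old ones; by quasi-convexity this happens outside an interval [l, h], so the
   quadratic (X - l)(X - h) has the sign of [g - lam] at every integer. *)
Lemma quasiconvex_tilt_variance n a g mu :
  (forall i, (i <= n)%N -> 0 <= a i) -> 0 < \sum_(i < n.+1) a i ->
  (forall i j m, (i <= j <= m)%N -> (m <= n)%N -> g j <= g i \/ g j <= g m) ->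
  \sum_(i < n.+1) (i%:R - mu) * a i = 0 ->
  \sum_(i < n.+1) (i%:R - mu) * (a i * g i) = 0 ->
  (\sum_(i < n.+1) a i * g i) * (\sum_(i < n.+1) (i%:R - mu) ^+ 2 * a i)
  <= (\sum_(i < n.+1) a i) * (\sum_(i < n.+1) (i%:R - mu) ^+ 2 * (a i * g i)).
Proof.
move=> a0 S0 gqc centered gcentered.
set S := \sum_(i < _) a i in S0 *; set Sg := \sum_(i < _) a i * g i.
set M2 := \sum_(i < _) _ * a i; set M2g := \sum_(i < _) _ * (a i * g i).
pose lam := Sg / S.
have [l [h lhP]] : exists l h : nat,
    forall i, (i <= n)%N -> 0 <= (i%:R - l%:R) * (i%:R - h%:R) * (g i - lam).
  have [/existsP[j0 j0low]|/existsPn nolow] :=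
      boolP [exists j : 'I_n.+1, g j < lam]; last first.
    exists 0%N, 0%N => i ilen; have := nolow (Ordinal (ilen : (i < n.+1)%N)).
    by rewrite -leNgt => lami; rewrite -expr2 mulr_ge0 ?sqr_ge0 ?subr_ge0.
  have exj : exists j, (j <= n)%N && (g j < lam).
    by exists j0; rewrite leq_ord.
  (* [l] and [h] are the first and last indices where [g] is below [lam]. *)
  case: (ex_minnP exj) => l /andP[ln gl] lmin.
  have ubj j : (j <= n)%N && (g j < lam) -> (j <= n)%N by case/andP.
  case: (ex_maxnP exj ubj) => h /andP[hn gh] hmax.
  exists l, h => i ilen; have [lami|glow] := lerP lam (g i).
    rewrite mulr_ge0 ?subr_ge0 //.
    have [il|li] := ltnP i l.
      have ih : (i <= h)%N by rewrite (leq_trans (ltnW il)) ?lmin ?hn.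
      by rewrite mulr_le0 ?subr_le0 ?ler_nat // ltnW.
    have [hi|ih] := leqP h i; first by rewrite mulr_ge0 ?subr_ge0 ?ler_nat.
    have ilh : (l <= i <= h)%N by rewrite li ltnW.
    by case: (gqc _ _ _ ilh hn) => /(le_trans lami); rewrite leNgt ?gl ?gh.
  have li : (l <= i)%N by rewrite lmin ?ilen.
  have ih : (i <= h)%N by rewrite hmax ?ilen.
  rewrite mulr_le0 ?subr_le0 ?(ltW glow) //.
  by rewrite mulr_ge0_le0 ?subr_ge0 ?subr_le0 ?ler_nat.
have : 0 <= \sum_(i < n.+1) (i%:R - l%:R) * (i%:R - h%:R) * (g i - lam) * a i.
  by apply: sumr_ge0 => i _; rewrite mulr_ge0 ?a0 ?lhP ?leq_ord.
(* Expand (X - l)(X - h) in powers of X - mu: the linear part vanishes by centering, the constant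
   part by the choice of [lam]. *)
have -> : \sum_(i < n.+1) (i%:R - l%:R) * (i%:R - h%:R) * (g i - lam) * a i =
    M2g - lam * M2
    + (2 * mu - l%:R - h%:R) * (\sum_(i < n.+1) (i%:R - mu) * (a i * g i)
                                - lam * \sum_(i < n.+1) (i%:R - mu) * a i)
    + (mu - l%:R) * (mu - h%:R) * (Sg - lam * S).
  rewrite /M2g /M2 /Sg /S !mulr_sumr -!sumrB !mulr_sumr -!big_split /=.
  by apply: eq_bigr => i _; ring.
rewrite centered gcentered !mulr0 subrr mulr0 addr0 /lam divfK ?gt_eqF //.
rewrite subrr mulr0 addr0 subr_ge0 -(ler_pM2l S0) => /(le_trans _); apply.
by rewrite le_eqVlt; apply/predU1P; left; field; rewrite gt_eqF.
Qed.

Lemma exists_sign_change (f : nat -> R) n : 0 <= f 0%N -> f n.+1 <= 0 ->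
  exists2 k, (k <= n)%N & 0 <= f k /\ f k.+1 <= 0.
Proof.
move=> f0; elim: n => [|n IH] fn; first by exists 0%N.
have [fneg|fpos] := lerP (f n.+1) 0; last by exists n.+1 => //; rewrite ltW.
by have [k kn fk] := IH fneg; exists k => //; rewrite ltnW.
Qed.

End Statistics.

(** * Monotonicity of the ratio of v_k to the given weights *)

Section Tilt.
Context {R : realFieldType} (Om : R) (Om0 : 0 < Om) (r : 'rV[R]_6).
Hypothesis hr : forall k : 'I_6, Om^-1 <= r 0 k <= Om.

Definition prefix i : R := \prod_(k < 6 | (k < i)%N) r 0 k.

Lemma rate_gt0 k : 0 < r 0 k.
Proof. by have /andP[+ _] := hr k; apply: lt_le_trans; rewrite invr_gt0. Qed.

Lemma prefix_gt0 i : 0 < prefix i.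
Proof. by apply: prodr_gt0 => k _; exact: rate_gt0. Qed.

Lemma prefixS (k : 'I_6) : prefix k.+1 = prefix k * r 0 k.
Proof.
rewrite /prefix (bigD1 k) //= mulrC; congr (_ * _); apply: eq_bigl => j.
by rewrite ltnS ltn_neqAle andbC.
Qed.

(** This is [vee] divided by [a]: binomials and powers of [u] cancel. *)
Definition tilt k i : R := Om ^+ ((i - k) + (k - i)) / prefix i.

(** A step towards [k] removes a factor [Om] above and adds a rate at least [Om^-1] below. *)
Lemma tilt_nonincreasing k i : (i < k)%N -> (i < 6)%N ->
  tilt k i.+1 <= tilt k i.
Proof.
move=> ik i6; rewrite /tilt (prefixS (Ordinal i6)) /=.
have -> : (i - k + (k - i) = (i.+1 - k + (k - i.+1)).+1)%N by lia.
have /andP[rge _] := hr (Ordinal i6).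
rewrite exprS ler_pdivrMr ?mulr_gt0 ?prefix_gt0 ?rate_gt0 //.
set E := Om ^+ _; have -> : Om * E / prefix i * (prefix i * r 0 (Ordinal i6)) =
    E * (Om * r 0 (Ordinal i6)) by field; rewrite gt_eqF ?prefix_gt0.
by rewrite ler_peMr ?exprn_ge0 ?(ltW Om0) // -ler_pdivrMl // mulr1.
Qed.

(** A step away from [k] adds a factor [Om] above and a rate at most [Om] below. *)
Lemma tilt_nondecreasing k i : (k <= i)%N -> (i < 6)%N ->
  tilt k i <= tilt k i.+1.
Proof.
move=> ki i6; rewrite /tilt (prefixS (Ordinal i6)) /=.
have -> : (i.+1 - k + (k - i.+1) = (i - k + (k - i)).+1)%N by lia.
have /andP[_ rle] := hr (Ordinal i6).
rewrite exprS ler_pdivrMr ?prefix_gt0 //.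
set E := Om ^+ _; have -> : Om * E / (prefix i * r 0 (Ordinal i6)) * prefix i =
    E * (Om / r 0 (Ordinal i6)).
  by field; rewrite !gt_eqF ?prefix_gt0 ?rate_gt0.
by rewrite ler_peMr ?exprn_ge0 ?(ltW Om0) // ler_pdivlMr ?rate_gt0 // mul1r.
Qed.

End Tilt.

(** * Matching the mean and comparing variances *)

Theorem proposition1 (R : realType) (Omega : R) (hOmega : 1 <= Omega)
    (u : R) (hu : 0 < u) (r : 'rV[R]_6)
    (hr : forall k : 'I_6, Omega^-1 <= r 0 k <= Omega) :
  q u r <= Omega.
Proof.
have Om0 : 0 < Omega by apply: lt_le_trans hOmega.
pose w i := a u r i; pose mu := mean u r; pose S := \sum_(i < 7) w i.
have P0 := prefix_gt0 Om0 hr.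
have w0 i : (i <= 6)%N -> 0 < w i.
  by move=> i6; rewrite !mulr_gt0 ?exprn_gt0 ?ltr0n ?bin_gt0 // P0.
have S0 : 0 < S.
  rewrite /S big_ord_recl ltr_pwDl ?w0 // sumr_ge0 // => i _.
  by rewrite ltW ?w0 ?ltn_ord.
have w_ge0 i : (i <= 6)%N -> 0 <= w i by move/w0/ltW.
have centered : \sum_(i < 7) (i%:R - mu) * w i = 0.
  under eq_bigr do rewrite mulrBl.
  rewrite sumrB -mulr_sumr -/S; apply/eqP; rewrite subr_eq0; apply/eqP.
  rewrite /mu /mean mulr_suml; apply: eq_bigr => i _.
  by rewrite /p -/(w i) -/S mulrA divfK ?gt_eqF.
have qE : q u r =
    (1 + u) ^+ 2 * (\sum_(i < 7) (i%:R - mu) ^+ 2 * w i) / (6 * u * S).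
  rewrite /q -/mu; under eq_bigr do rewrite /p -/(w _) -/S mulrA.
  by rewrite -mulr_suml; field; rewrite !gt_eqF.
rewrite {}qE ler_pdivrMr ?mulr_gt0 //; clearbody mu.
have wtilt k i : w i * tilt Omega r k i = vee u Omega k i.
  rewrite /w /a /tilt /vee -/(prefix r i); field.
  by rewrite gt_eqF ?P0.
have tilt_le k i j : (i <= j <= 6)%N -> (k <= i)%N ->
    tilt Omega r k i <= tilt Omega r k j.
  case/andP=> ij j6 ki; elim: j ij j6 => [|j IH].
    by rewrite leqn0 => /eqP->.
  rewrite leq_eqVlt => /predU1P[-> //|ij] j6.
  by rewrite (le_trans (IH ij (ltnW j6))) ?tilt_nondecreasing // (leq_trans ki).
have tilt_ge k i j : (i <= j <= 6)%N -> (j <= k)%N ->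
    tilt Omega r k j <= tilt Omega r k i.
  case/andP=> ij j6; elim: j ij j6 => [|j IH].
    by rewrite leqn0 => /eqP->.
  rewrite leq_eqVlt => /predU1P[-> //|ij] j6 jk.
  by rewrite (le_trans _ (IH ij (ltnW j6) (ltnW jk))) ?tilt_nonincreasing.
pose f k := \sum_(i < 7) (i%:R - mu) * vee u Omega k i.
have f0 : 0 <= f 0%N.
  have : 0 <= \sum_(i < 7) (i%:R - mu) * (w i * tilt Omega r 0 i).
    apply: (nondecreasing_tilt_mean (g := tilt Omega r 0) w_ge0) => // i j ij.
    exact: tilt_le.
  by under eq_bigr do rewrite wtilt.
have f6 : f 6%N <= 0.
  have : 0 <= \sum_(i < 7) (i%:R - mu) * (w i * - tilt Omega r 6 i).
    pose g i := - tilt Omega r 6 i.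
    apply: (nondecreasing_tilt_mean (g := g) w_ge0) => //.
    move=> i j ij; rewrite /g lerN2 tilt_ge //.
    by case/andP: ij.
  under eq_bigr do rewrite mulrN wtilt mulrN.
  by rewrite sumrN oppr_ge0.
have [k k5 [fk fk1]] := exists_sign_change f0 f6.
(* Cross weights [- f k.+1] and [f k] cancel the mean; if [f k = 0] they might both vanish, and v_k
   alone serves. *)
have [s [t [s0 t0 st0 stf]]] : exists s t : R,
    [/\ 0 <= s, 0 <= t, 0 < s + t & s * f k + t * f k.+1 = 0].
  have [fk00|fkn0] := eqVneq (f k) 0.
    by exists 1, 0; split; rewrite ?fk00 ?addr0 ?mulr0 ?mul0r ?addr0.
  exists (- f k.+1), (f k); split=> //; rewrite ?oppr_ge0 //; last by ring.
  by rewrite ltr_wpDl ?oppr_ge0 // lt_neqAle eq_sym fkn0.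
pose g i := s * tilt Omega r k i + t * tilt Omega r k.+1 i.
pose b i := s * vee u Omega k i + t * vee u Omega k.+1 i.
have wg i : w i * g i = b i by rewrite /b -!wtilt /g; ring.
have bcentered : \sum_(i < 7) (i%:R - mu) * (w i * g i) = 0.
  transitivity (s * f k + t * f k.+1) => //.
  rewrite /f !mulr_sumr -big_split /=; apply: eq_bigr => i _.
  by rewrite wg /b; ring.
(* Both tilts decrease weakly up to [k] and increase weakly from [k.+1] on, and no integer lies
   between. *)
have gqc i j m : (i <= j <= m)%N -> (m <= 6)%N -> g j <= g i \/ g j <= g m.
  case/andP=> ij jm m6; have j6 := leq_trans jm m6.
  have [jk|kj] := leqP j k; [left|right]; rewrite lerD ?ler_wpM2l //.
  - by rewrite tilt_ge ?ij.
  - by rewrite tilt_ge ?ij // leqW.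
  - by rewrite tilt_le ?jm // ltnW.
  - by rewrite tilt_le ?jm.
have varle := quasiconvex_tilt_variance w_ge0 S0 gqc centered bcentered.
have vee_gt0 l i : (i <= 6)%N -> 0 < vee u Omega l i.
  by move=> i6; rewrite !mulr_gt0 ?exprn_gt0 ?ltr0n ?bin_gt0.
have mbE d : moment b d =
    s * moment (vee u Omega k) d + t * moment (vee u Omega k.+1) d.
  rewrite /moment !mulr_sumr -big_split /=.
  by apply: eq_bigr => i _; rewrite /b; ring.
have b0 : 0 < moment b 0.
  have m0 l : 0 < moment (vee u Omega l) 0.
    rewrite /moment big_ord_recl expr0 mul1r ltr_pwDl ?vee_gt0 //.
    by rewrite sumr_ge0 // => i _; rewrite mulr_ge0 // ltW // vee_gt0 ?ltn_ord.
  rewrite mbE; move: s0; rewrite le_eqVlt => /predU1P[s0|s0].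
    by rewrite -s0 add0r in st0; rewrite -s0 mul0r add0r mulr_gt0.
  by rewrite ltr_pwDl ?mulr_ge0 ?mulr_gt0 // ltW.
have bound : (1 + u) ^+ 2 * (moment b 0 * moment b 2 - moment b 1 ^+ 2)
    <= 6 * u * Omega * moment b 0 ^+ 2.
  have [k6 kS6] : (k <= 6)%N /\ (k.+1 <= 6)%N by rewrite leqW.
  have H1 := vee_slack_ge0 hu hOmega k6 k6 (or_introl erefl).
  have H2 := vee_slack_ge0 hu hOmega k6 kS6 (or_intror erefl).
  have H3 := vee_slack_ge0 hu hOmega kS6 kS6 (or_introl erefl).
  rewrite -subr_ge0 in H1; rewrite -subr_ge0 in H2; rewrite -subr_ge0 in H3.
  rewrite !mbE -subr_ge0.
  move: H1 H2 H3; set D1 := (X in 0 <= X -> _); set D2 := (X in _ -> 0 <= X -> _).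
  set D3 := (X in _ -> _ -> 0 <= X -> _) => D10 D20 D30.
  (* On the diagonal the polarized form is twice the quadratic one, hence the halves. *)
  rewrite [leRHS](_ : _ = s ^+ 2 / 2 * D1 + s * t * D2 + t ^+ 2 / 2 * D3).
    by rewrite !addr_ge0 ?mulr_ge0 ?exprn_ge0 ?invr_ge0.
  by rewrite /D1 /D2 /D3; field.
have S_b : \sum_(i < 7) w i * g i = moment b 0.
  by apply: eq_bigr => i _; rewrite wg mul1r.
have b1 : moment b 1 = mu * moment b 0.
  apply/eqP; rewrite -subr_eq0; apply/eqP.
  apply: etrans bcentered; rewrite /moment mulr_sumr -sumrB.
  by apply: eq_bigr => i _; rewrite wg; ring.
have M2b : \sum_(i < 7) (i%:R - mu) ^+ 2 * (w i * g i)
    = moment b 2 - mu * moment b 1.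
  transitivity (moment b 2 - 2 * mu * moment b 1 + mu ^+ 2 * moment b 0);
    last by rewrite b1; ring.
  rewrite /moment !mulr_sumr -sumrB -big_split /=.
  apply: eq_bigr => i _; by rewrite wg; ring.
rewrite S_b M2b -/S in varle.
(* [varle] bounds [moment b 0] times the old second moment, so the goal is scaled by that factor;
   [bound] carries its square, and one copy cancels. *)
rewrite -(ler_pM2l b0).
set M2w := \sum_(i < 7) _ in varle *.
have u20 : 0 <= (1 + u) ^+ 2 by rewrite sqr_ge0.
have := ler_wpM2l u20 varle; have := ler_wpM2l (ltW S0) bound.
rewrite b1 => H1 H2.
have H3 : moment b 0 *
      ((1 + u) ^+ 2 * (S * (moment b 2 - mu * (mu * moment b 0))))
    <= moment b 0 * (Omega * (6 * u * S) * moment b 0).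
  rewrite -[leRHS](_ : S * (6 * u * Omega * moment b 0 ^+ 2) = _); last by ring.
  by apply: le_trans H1; rewrite le_eqVlt; apply/predU1P; left; ring.
rewrite (ler_pM2l b0) in H3.
by rewrite mulrCA [leRHS]mulrC; apply: le_trans H3.
Qed.
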